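(* Consider the storage-investment game between two suppliers with storage costs $C_1,C_2\ge0$. Then: - $S_0S_0$ (i.e. $\varphi_1=\varphi_2=0$) is a pure storage-investment equilibrium if $C_i\in[\pi_i^{S_1S_0|Y}-\pi_i^{S_0S_0},+\infty)$ for both $i=1,2$. - $S_1S_0$ with $\varphi_i=1$ and $\varphi_{-i}=0$ is a pure storage-investment equilibrium if $C_i\in[0,\pi_i^{S_1S_0|Y}-\pi_i^{S_0S_0}]$ and $C_{-i}\in[\pi_{-i}^{S_1S_1}-\pi_{-i}^{S_1S_0|N},+\infty)$. - $S_1S_1$ (i.e. $\varphi_1=\varphi_2=1$) is a pure storage-investment equilibrium if $C_i\in[0,\pi_i^{S_1S_1}-\pi_i^{S_1S_0|N}]$ for both $i=1,2$. If $(C_1,C_2)$ satisfies none of the conditions above, there exists no pure storage-investment equilibrium. (An interval $[0,a]$ with $a<0$ is the empty set.)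
   Context: Two suppliers $i\in\{1,2\}$ ($-i$ denotes the other) simultaneously choose $\varphi_i\in\{0,1\}$ ($1$ = invest in storage, $0$ = not invest). Each pair $\boldsymbol\varphi$ leads to a price-quantity competition subgame in a local energy market at each hour $t$ of each month-type $m$, in which supplier $i$ has an equilibrium revenue $\pi_i^{RE,m,t}(\boldsymbol\varphi)$. The payoff of supplier $i$ is his expected profit $\Pi_i(\boldsymbol\varphi)=\mathbb E_{m,t}[\pi_i^{RE,m,t}(\boldsymbol\varphi)]-\varphi_iC_i$, where $C_i$ is his storage cost. Expected equilibrium revenues $\mathbb E_{m,t}[\pi_i^{RE,m,t}(\boldsymbol\varphi)]$ are denoted: $\pi_i^{S_1S_1}$ when both invest; $\pi_i^{S_0S_0}$ when neither invests; $\pi_i^{S_1S_0|Y}$ when $i$ invests and $-i$ does not; $\pi_i^{S_1S_0|N}$ when $i$ does not invest and $-i$ does. For the claim these may be regarded as given real numbers. A vector $\boldsymbol\varphi^*$ is a pure storage-investment equilibrium if $\Pi_i(\varphi_i^*,\varphi_{-i}^* )\ge\Pi_i(\varphi_i,\varphi_{-i}^* )$ for any $\varphi_i\neq\varphi_i^*$ and any $i=1,2$. *)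

(* Defs.v *)
From mathcomp Require Import all_boot all_order all_algebra.
From mathcomp Require Import reals.

Set Implicit Arguments.
Unset Strict Implicit.
Unset Printing Implicit Defensive.

Import Order.TTheory GRing.Theory Num.Theory.

Local Open Scope ring_scope.

Definition supplier := 'I_2.

Definition other (i : supplier) : supplier := rev_ord i.

(* [true] (coerced to 1) = invest in storage, [false] (0) = do not invest. *)
Definition profile := {ffun supplier -> bool}.

(* The pair (phi_i, phi_{-i}) = (a, b), written from the viewpoint of i. *)
Definition play (i : supplier) (a b : bool) : profile :=
  [ffun j => if j == i then a else b].

Section StorageGame.

Variable R : realType.

(* [er i phi] is the expected equilibrium revenue E_{m,t}[pi_i^{RE,m,t}(phi)]
   of supplier i in the market subgames induced by phi; [C i] is the storage
   cost of supplier i. *)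
Variables (er : supplier -> profile -> R) (C : supplier -> R).

Definition profit (i : supplier) (phi : profile) : R :=
  er i phi - (phi i)%:R * C i.

Definition pure_equilibrium (phi : profile) : Prop :=
  forall (i : supplier) (a : bool), a != phi i ->
    profit i phi >= profit i (play i a (phi (other i))).

Definition revS1S1 (i : supplier) : R := er i (play i true true).
Definition revS0S0 (i : supplier) : R := er i (play i false false).
(* Only one supplier invests: i itself ([Y]), or its opponent ([N]). *)
Definition revS1S0Y (i : supplier) : R := er i (play i true false).
Definition revS1S0N (i : supplier) : R := er i (play i false true).

Definition cond_S0S0 : Prop :=
  forall i : supplier, C i \in `[revS1S0Y i - revS0S0 i, +oo[.

(* Here i is the supplier who invests. *)
Definition cond_S1S0 (i : supplier) : Prop :=
  C i \in `[0, revS1S0Y i - revS0S0 i] /\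
  C (other i) \in `[revS1S1 (other i) - revS1S0N (other i), +oo[.

Definition cond_S1S1 : Prop :=
  forall i : supplier, C i \in `[0, revS1S1 i - revS1S0N i].

End StorageGame.

(* Main.v *)
Require Import Defs.
From mathcomp Require Import all_boot all_order all_algebra.
From mathcomp Require Import reals.

Import Order.TTheory GRing.Theory Num.Theory.

Local Open Scope ring_scope.

(** Given the opponent's choice, a supplier weakly prefers investing exactly
    when the storage cost is at most the revenue gained by investing. Each of
    the three cost conditions says that this threshold rule holds for both
    suppliers, so, costs being nonnegative, it is equivalent to its profile
    being an equilibrium; and every profile is of one of the three kinds. *)

Lemma other_neq (i : supplier) : (other i == i) = false.
Proof. by case: i => -[|[|]]. Qed.

Lemma otherK : involutive other.
Proof. exact: rev_ordK. Qed.

Lemma supplier_dichotomy (i j : supplier) : j = i \/ j = other i.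
Proof.
by case: i j => -[|[|]] // ? [[|[|]]] // ?; [left|right|right|left];
  apply/val_inj.
Qed.

Lemma play_self (i : supplier) (a b : bool) : play i a b i = a.
Proof. by rewrite ffunE eqxx. Qed.

Lemma play_other (i : supplier) (a b : bool) : play i a b (other i) = b.
Proof. by rewrite ffunE other_neq. Qed.

Lemma play_eta (i : supplier) (phi : profile) :
  play i (phi i) (phi (other i)) = phi.
Proof.
by apply/ffunP => j; case: (supplier_dichotomy i j) => ->;
  rewrite (play_self, play_other).
Qed.

(** A profile can be read from either supplier's viewpoint; this brings a lone investor into the
    first position, as [cond_S1S0] expects. *)
Lemma play_swap (i : supplier) (a b : bool) : play (other i) a b = play i b a.
Proof. by rewrite -[RHS](play_eta (other i)) otherK play_self play_other. Qed.

Lemma play_diag (i : supplier) (a : bool) : play i a a = [ffun _ => a].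
Proof. by apply/ffunP => j; rewrite !ffunE if_same. Qed.

Section Equilibria.

Context {R : realType} (er : supplier -> profile -> R) (C : supplier -> R).

(** Both thresholds of the cost conditions in one formula: [b = false] gives
    [revS1S0Y i - revS0S0 i], and [b = true] gives [revS1S1 i - revS1S0N i]. *)
Definition investment_gain (i : supplier) (b : bool) : R :=
  er i (play i true b) - er i (play i false b).

(** With two actions the only deviation is [~~ a], so a single profit comparison decides. *)
Lemma best_responseP (i : supplier) (a b : bool) :
  (forall a', a' != a ->
     profit er C i (play i a b) >= profit er C i (play i a' b)) <->
  if a then C i <= investment_gain i b else investment_gain i b <= C i.
Proof.
have best_deviation : (forall a', a' != a ->
     profit er C i (play i a b) >= profit er C i (play i a' b)) <->
   profit er C i (play i (~~ a) b) <= profit er C i (play i a b).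
  by split=> [|] dev; [apply: dev; case: a|case: a dev => ? []].
rewrite best_deviation /profit /investment_gain !play_self.
(* In both cases [C i] and the revenue from not investing trade sides of the inequality. *)
by case: a {best_deviation};
  rewrite /= mul0r mul1r subr0 (lerBrDr, lerBlDr) addrC -(lerBrDr, lerBlDr).
Qed.

Lemma pure_equilibriumP (phi : profile) :
  pure_equilibrium er C phi <->
  forall i, if phi i then C i <= investment_gain i (phi (other i))
            else investment_gain i (phi (other i)) <= C i.
Proof.
by split=> eq_phi i; have := eq_phi i; rewrite -best_responseP play_eta.
Qed.

Lemma cond_S0S0P :
  cond_S0S0 er C <-> pure_equilibrium er C [ffun _ => false].
Proof.
rewrite pure_equilibriumP.
by split=> H i; move: (H i); rewrite !ffunE in_itv /= andbT.
Qed.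

Hypothesis C_ge0 : forall i, 0 <= C i.

(** Since costs are nonnegative, the lower endpoint of the interval for [C i] is automatic, which
    leaves one threshold inequality per supplier. *)
Lemma cond_S1S0P (i : supplier) :
  cond_S1S0 er C i <-> pure_equilibrium er C (play i true false).
Proof.
rewrite pure_equilibriumP /cond_S1S0 !in_itv /= C_ge0 andbT /=; split.
  move=> [invest_i idle_other] j; case: (supplier_dichotomy i j) => ->.
    by rewrite play_self play_other.
  by rewrite otherK play_self play_other.
move=> H; split; first by move: (H i); rewrite play_self play_other.
by move: (H (other i)); rewrite otherK play_self play_other.
Qed.

Lemma cond_S1S1P :
  cond_S1S1 er C <-> pure_equilibrium er C [ffun _ => true].
Proof.
rewrite pure_equilibriumP.
by split=> H i; move: (H i); rewrite !ffunE in_itv /= C_ge0.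
Qed.

End Equilibria.

Theorem theorem4 (R : realType) (er : supplier -> profile -> R)
    (C : supplier -> R) (hC : forall i : supplier, 0 <= C i) :
  [/\ cond_S0S0 er C ->
        pure_equilibrium er C [ffun _ : supplier => false],
      forall i : supplier, cond_S1S0 er C i ->
        pure_equilibrium er C (play i true false),
      cond_S1S1 er C ->
        pure_equilibrium er C [ffun _ : supplier => true]
    & ~ cond_S0S0 er C -> (forall i : supplier, ~ cond_S1S0 er C i) ->
        ~ cond_S1S1 er C ->
        ~ exists phi : profile, pure_equilibrium er C phi].
Proof.
split=> [/cond_S0S0P //|i /(cond_S1S0P _ _ hC) //|/(cond_S1S1P _ _ hC) //|].
move=> not00 not10 not11 [phi]; rewrite -(play_eta ord0 phi).
case: (phi ord0); case: (phi (other ord0)).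
- by rewrite play_diag => /(cond_S1S1P _ _ hC).
- by move=> /(cond_S1S0P _ _ hC); apply: not10.
(* Here [ord0] stays idle, so the profile is reread with [other ord0] as the investor. *)
- by rewrite -play_swap => /(cond_S1S0P _ _ hC); apply: not10.
- by rewrite play_diag => /cond_S0S0P.
Qed.
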